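(* Let $K$ be a field, let $K\langle X\rangle$ be the free associative $K$-algebra on a finite set $X$ of at least two variables, and let $f\in K\langle X\rangle\setminus K$. Then the centralizer $C=C(f;K\langle X\rangle)=\{g\in K\langle X\rangle: gf=fg\}$ (which is a commutative domain) is integrally closed, i.e. integrally closed in its field of fractions.
   Context: For a $K$-algebra $A$ and $a\in A$, the centralizer $C(a;A)$ is the subalgebra of all elements of $A$ commuting with $a$. It is known that the centralizer of a non-scalar element of $K\langle X\rangle$ is a commutative $K$-subalgebra of transcendence degree one. *)

(* Defs.v *)
From HB Require Import structures.
From mathcomp Require Import all_boot all_order all_algebra.
From mathcomp Require Import finmap monalg ring.
From Stdlib Require Import FunctionalExtensionality Classical_Prop.

Set Implicit Arguments.
Unset Strict Implicit.
Unset Printing Implicit Defensive.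

Import GRing.Theory.
Local Open Scope ring_scope.

(* Formal power series in non-commuting variables, as functions on words. The  *)
(* product recurses on the word through the left derivations [deriv].          *)
Module Series.
Section Series.
Variables (K : fieldType) (X : finType).

Notation series := (seq X -> K).
Implicit Types (a b c f r u : series) (w s t : seq X) (x : X).

Definition deriv x a : series := fun w => a (x :: w).
Definition strip t a : series := fun w => a (t ++ w).
Definition one : series := fun w => (w == [::])%:R.

Fixpoint mul a b w : K :=
  if w is x :: w' then mul (deriv x a) b w' + a [::] * b w
  else a [::] * b [::].

Lemma seriesP a b : a =1 b -> a = b.
Proof. exact: functional_extensionality. Qed.

Lemma derivM x a b :
  deriv x (mul a b) = fun w => mul (deriv x a) b w + a [::] * deriv x b w.
Proof. by []. Qed.

Lemma mulDl a a' b w :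
  mul (fun w => a w + a' w) b w = mul a b w + mul a' b w.
Proof.
elim: w a a' => [|x w IH] a a' /=; first by rewrite mulrDl.
by rewrite -/(deriv x _) IH mulrDl addrACA.
Qed.

Lemma mulDr a b b' w :
  mul a (fun w => b w + b' w) w = mul a b w + mul a b' w.
Proof.
elim: w a => [|x w IH] a /=; first by rewrite mulrDr.
by rewrite IH mulrDr addrACA.
Qed.

Lemma mulZl k a b w : mul (fun w => k * a w) b w = k * mul a b w.
Proof.
elim: w a => [|x w IH] a /=; first by rewrite mulrA.
by rewrite IH mulrDr mulrA.
Qed.

Lemma mulZr k a b w : mul a (fun w => k * b w) w = k * mul a b w.
Proof.
elim: w a => [|x w IH] a /=; first by rewrite mulrCA.
by rewrite IH mulrDr mulrCA.
Qed.

Lemma mulBl a a' b w :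
  mul (fun w => a w - a' w) b w = mul a b w - mul a' b w.
Proof.
elim: w a a' => [|x w IH] a a' /=; first by rewrite mulrBl.
by rewrite -/(deriv x _) IH mulrBl opprD addrACA.
Qed.

Lemma mulBr a b b' w :
  mul a (fun w => b w - b' w) w = mul a b w - mul a b' w.
Proof.
elim: w a => [|x w IH] a /=; first by rewrite mulrBr.
by rewrite IH mulrBr opprD addrACA.
Qed.

Lemma deriv0 x : deriv x (fun=> 0) = fun=> 0.
Proof. by []. Qed.

Lemma mul0l b w : mul (fun=> 0) b w = 0.
Proof. by elim: w => [|x w IH] /=; rewrite ?deriv0 ?IH GRing.mul0r ?addr0. Qed.

Lemma mul0r a w : mul a (fun=> 0) w = 0.
Proof. by elim: w a => [|x w IH] a /=; rewrite ?IH mulr0 ?addr0. Qed.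

Lemma deriv_one x : deriv x one = fun=> 0.
Proof. by apply: seriesP. Qed.

Lemma mul1l b : mul one b = b.
Proof.
apply: seriesP => -[|x w] /=; first by rewrite /one eqxx GRing.mul1r.
by rewrite deriv_one mul0l add0r /one eqxx GRing.mul1r.
Qed.

Lemma mul1r a : mul a one = a.
Proof.
apply: seriesP => w; elim: w a => [|x w IH] a /=; first by rewrite mulr1.
by rewrite IH mulr0 addr0.
Qed.

Lemma mulA a b c : mul a (mul b c) = mul (mul a b) c.
Proof.
apply: seriesP => w; elim: w a b c => [|x w IH] a b c /=; first by rewrite mulrA.
by rewrite IH derivM mulDl mulZl mulrDr GRing.mulrA addrA.
Qed.

Fixpoint inv_rec u a w : K :=
  if w is x :: w' then
    inv_rec u (deriv x a) w' - a [::] * (u [::])^-1 * inv_rec u (deriv x u) w'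
  else a [::] * (u [::])^-1.

Definition inv u := inv_rec u one.

Lemma inv_rec0 u w : inv_rec u (fun=> 0) w = 0.
Proof.
elim: w => [|x w IH] /=; first by rewrite GRing.mul0r.
by rewrite deriv0 IH !GRing.mul0r subr0.
Qed.

Lemma inv_nil u : inv u [::] = (u [::])^-1.
Proof. by rewrite /inv /= /one eqxx GRing.mul1r. Qed.

Lemma inv_cons u x w :
  inv u (x :: w) = - ((u [::])^-1 * inv_rec u (deriv x u) w).
Proof. by rewrite /inv /= deriv_one inv_rec0 /one eqxx GRing.mul1r add0r. Qed.

Lemma inv_recE u a : inv_rec u a = mul a (inv u).
Proof.
apply: seriesP => w; elim: w a => [|x w IH] a /=; first by rewrite inv_nil.
by rewrite inv_cons IH mulrN mulrA.
Qed.

Lemma mulrV u : u [::] != 0 -> mul u (inv u) = one.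
Proof.
move=> u0; rewrite -inv_recE; apply: seriesP => -[|x w] /=; rewrite divff //.
by rewrite GRing.mul1r subrr.
Qed.

Lemma mulVr u : u [::] != 0 -> mul (inv u) u = one.
Proof.
move=> u0; have v0 : inv u [::] != 0 by rewrite inv_nil invr_eq0.
have def_u : u = inv (inv u).
  by rewrite -[LHS]mul1r -(mulrV v0) mulA (mulrV u0) mul1l.
by rewrite {2}def_u mulrV.
Qed.

Definition order_ge n a := forall w, (size w < n)%N -> a w = 0.

Lemma order_geM m n a b :
  order_ge m a -> order_ge n b -> order_ge (m + n) (mul a b).
Proof.
move=> am bn w; elim: w m a am => [|x w IH] [|m] a am /= lt_w.
- by rewrite (bn [::]) // mulr0.
- by rewrite (am [::]) // GRing.mul0r.
- by rewrite (IH 0%N) ?bn ?mulr0 ?addr0 //; apply: ltnW.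
rewrite (IH m) ?(am [::]) ?GRing.mul0r ?addr0 //.
by move=> v lt_v; apply: am.
Qed.

Lemma orderP a w : a w != 0 -> exists2 t, a t != 0 & order_ge (size t) a.
Proof.
move=> aw; pose P n := [exists t : n.-tuple X, a t != 0].
have exP : exists n, P n by exists (size w); apply/existsP; exists (in_tuple w).
case: (ex_minnP exP) => n /existsP[t at0] min_n; exists (tval t) => // v.
rewrite size_tuple => lt_v; apply: contraTeq lt_v => av.
by rewrite -leqNgt; apply: min_n; apply/existsP; exists (in_tuple v).
Qed.

Lemma stripM t a b :
  order_ge (size t) a -> strip t (mul a b) = mul (strip t a) b.
Proof.
elim: t a => [|x t IH] a at0 //.
have dat : order_ge (size t) (deriv x a) by move=> w lt_w; apply: at0.
apply: seriesP => w; rewrite -[RHS](congr1 (@^~ w) (IH _ dat)) /strip /=.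
by rewrite (at0 [::]) // GRing.mul0r addr0.
Qed.

Lemma strip0 t a : strip t a [::] = a t.
Proof. by rewrite /strip cats0. Qed.

Lemma mul_neq0 a b s t :
  a s != 0 -> b t != 0 -> exists w, mul a b w != 0.
Proof.
move=> /orderP[{}s as0 ord_a] /orderP[{}t bt0 ord_b]; exists (s ++ t).
rewrite -[mul a b _]/(strip s (mul a b) t) stripM //.
move: bt0 ord_b; set u := strip s a; have u0: u [::] != 0 by rewrite /u strip0.
case: t => [|x t] bt0 ord_b /=; first by rewrite mulf_neq0.
rewrite (@order_geM 0 (size t).+1) ?add0r ?mulf_neq0 //.
Qed.

Lemma mulIr0 a b t : b t != 0 -> mul a b =1 (fun=> 0) -> a =1 (fun=> 0).
Proof.
move=> bt0 ab0 s; apply/eqP; apply: contraT => as0.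
by have [w] := mul_neq0 as0 bt0; rewrite ab0 eqxx.
Qed.

Definition comm f a := mul a f = mul f a.

Lemma comm_cancel f a b r t :
  a t != 0 -> comm f a -> comm f b -> b = mul r a -> comm f r.
Proof.
move=> at0 fa fb def_b; apply: seriesP => w; apply/eqP; rewrite -subr_eq0.
apply/eqP; move: w; apply: (mulIr0 at0) => w; rewrite mulBl -!mulA -fa.
by rewrite mulA -def_b fb subrr.
Qed.

Lemma commBC f a k : comm f a -> comm f (fun w => a w - k * one w).
Proof.
move=> fa; apply: seriesP => w.
by rewrite mulBl mulBr mulZl mulZr mul1l mul1r fa.
Qed.

(* Two elements commuting with [F], the order of which is large, are both     *)
(* right divisors of [F].                                                     *)
Lemma rdvd_high F a t :
  a t != 0 -> order_ge (size t) a -> order_ge (size t) F -> comm F a ->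
  exists p, F = mul p a.
Proof.
move=> at0 ord_a ord_F FaC; exists (mul (inv (strip t a)) (strip t F)).
by rewrite -mulA -stripM // -FaC stripM // mulA mulVr ?strip0 // mul1l.
Qed.

Lemma rdvd_same p q a b s :
  q s != 0 -> order_ge (size s) q -> order_ge (size s) p -> mul p a = mul q b ->
  exists r, b = mul r a.
Proof.
move=> qs0 ord_q ord_p pa_qb; exists (mul (inv (strip s q)) (strip s p)).
by rewrite -mulA -stripM // pa_qb stripM // mulA mulVr ?strip0 // mul1l.
Qed.

Fixpoint pow f n := if n is n'.+1 then mul f (pow f n') else one.

Lemma comm_pow f a n : comm f a -> comm (pow f n) a.
Proof.
move=> fa; elim: n => [|n IH]; first by rewrite /comm mul1l mul1r.
by rewrite /comm /= mulA fa -mulA IH mulA.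
Qed.

Lemma order_pow f n : f [::] = 0 -> order_ge n (pow f n).
Proof.
move=> f0; elim: n => [|n IH]; first by [].
by apply: (@order_geM 1 n) => // -[].
Qed.

Lemma pow_neq0 f t n : f t != 0 -> exists s, pow f n s != 0.
Proof.
move=> ft0; elim: n => [|n [s IH]]; first by exists [::]; apply: oner_neq0.
exact: mul_neq0 ft0 IH.
Qed.

Lemma comm_chain f a b t s s' :
    f [::] = 0 -> f t != 0 -> comm f a -> comm f b -> a s != 0 -> b s' != 0 ->
  (exists2 r, comm f r & b = mul r a) \/ (exists2 r, comm f r & a = mul r b).
Proof.
move=> f0 ft0 fa fb /orderP[{}s as0 ord_a] /orderP[{}s' bs0 ord_b].
pose F := pow f (size s + size s').
have ord_F: order_ge (size s + size s') F by apply: order_pow.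
have [w Fw0] : exists w, F w != 0 by apply: pow_neq0 ft0.
have [p Fp] : exists p, F = mul p a.
  apply: (rdvd_high as0) => //; last exact: comm_pow.
  by move=> v lt_v; apply: ord_F; apply: ltn_addr.
have [q Fq] : exists q, F = mul q b.
  apply: (rdvd_high bs0) => //; last exact: comm_pow.
  by move=> v lt_v; apply: ord_F; apply: ltn_addl.
have nz c d : F = mul c d -> exists v, c v != 0.
  move=> Fcd; pose P n := [exists v : n.-tuple X, c v != 0].
  case: (boolP [exists n : 'I_(size w).+1, P n]) => [/existsP[n /existsP[v ?]]|].
    by exists (tval v).
  move/existsPn => c0; case/eqP: Fw0; rewrite Fcd.
  apply: (@order_geM (size w).+1 0) => // [v lt_v|]; last by rewrite addn0.
  apply/eqP; apply: contraT => cv; case/negP: (c0 (Ordinal lt_v)).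
  by apply/existsP; exists (in_tuple v).
have [v /orderP[{}v pv0 ord_p]] := nz _ _ Fp.
have [v' /orderP[{}v' qv0 ord_q]] := nz _ _ Fq.
have [le_v|/ltnW le_v] := leqP (size v) (size v'); [right|left].
  have [r ab] : exists r, a = mul r b.
    apply: (@rdvd_same q p b a _ pv0) => //; last by rewrite -Fq.
    by move=> z lt_z; apply: ord_q; apply: leq_trans le_v.
  by exists r => //; apply: comm_cancel bs0 fb fa ab.
have [r ba] : exists r, b = mul r a.
  apply: (@rdvd_same p q a b _ qv0) => //; last by rewrite -Fp.
  by move=> z lt_z; apply: ord_p; apply: leq_trans le_v.
by exists r => //; apply: comm_cancel as0 fa fb ba.
Qed.

Lemma comm_uniformizer f p :
    p [::] = 0 -> comm f p ->
    (forall b, comm f b -> b [::] = 0 -> exists2 r, comm f r & b = mul r p) ->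
  forall a b, comm f a -> comm f b -> mul a b = mul b a.
Proof.
move=> p0 fp unif.
suff step n : forall a b, comm f a -> comm f b ->
    order_ge n (fun w => mul a b w - mul b a w).
  move=> a b fa fb; apply: seriesP => w; apply/eqP; rewrite -subr_eq0.
  by apply/eqP; apply: (step (size w).+1 a b fa fb).
elim: n => [//|n IH] a b fa fb.
have split c : comm f c -> exists k, exists2 r, comm f r &
    forall w, c w = mul r p w + k * one w.
  move=> fc; exists (c [::]).
  have [||r fr def_r] := unif (fun w => c w - c [::] * one w).
  - exact: commBC.
  - by rewrite /one mulr1 subrr.
  by exists r => // w; rewrite -def_r subrK.
have [k [r fr def_a]] := split a fa; have [l [s fs def_b]] := split b fb.
have {}def_a := seriesP def_a; have {}def_b := seriesP def_b.
pose g w := mul (mul r p) s w - mul (mul s p) r w.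
have ord_g : order_ge n g.
  have E w : g w = (mul r (fun w => mul p s w - mul s p w) w
                  + mul (fun w => mul r s w - mul s r w) p w)
                  + mul s (fun w => mul r p w - mul p r w) w.
    by rewrite !mulBr mulBl !mulA !subrKA.
  move=> w lt_w; rewrite E.
  have -> := @order_geM 0 n r _ _ (IH p s fp fs) w lt_w; last by [].
  have -> := @order_geM n 0 _ p (IH r s fr fs) _ w; rewrite ?addn0 //.
  by have -> := @order_geM 0 n s _ _ (IH r p fr fp) w lt_w; rewrite ?addr0.
have {}ord_g : order_ge n.+1 (mul g p).
  by rewrite -addn1; apply: (@order_geM n 1) => // -[].
move=> w lt_w; rewrite -[RHS](ord_g w lt_w) /g mulBl def_a def_b.
rewrite !mulDl !mulDr !mulZl !mulZr !mul1l !mul1r -!mulA.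
by ring.
Qed.
End Series.
End Series.

(* The words in the alphabet [X] are the monomials of the free algebra.        *)
Definition word (X : Type) := seq X.

HB.instance Definition _ (X : choiceType) := Choice.on (word X).

Fact word_unit (X : Type) (s t : word X) : s ++ t = [::] -> s = [::] /\ t = [::].
Proof. by case: s. Qed.

HB.instance Definition _ (X : choiceType) :=
  Choice_isMonomialDef.Build (word X) (@catA X) (@cat0s X) (@cats0 X)
    (@word_unit X).

Notation free_algebra K X := {malg K[word X]}.

Section FreeAlgebra.
Variables (K : fieldType) (X : finType).
Implicit Types (f g h : free_algebra K X) (s t w : word X).

Definition series_of g : seq X -> K := fun w => g@_(w : word X).

Lemma series_of_inj : injective series_of.
Proof. by move=> g h gh; apply/malgP => w; apply: (congr1 (@^~ w) gh). Qed.

Lemma series_of_neq0 g : g != 0 -> exists w, series_of g w != 0.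
Proof.
rewrite -msupp_eq0 => /fset0Pn[w]; rewrite -mcoeff_neq0 => gw; by exists w.
Qed.

Lemma series_of1 : series_of 1 = @Series.one K X.
Proof. by apply: Series.seriesP => w; rewrite /series_of mcoeff1. Qed.

Lemma series_of_monomialM (c d : K) s t w :
  Series.mul (fun v => c *+ (s == v)) (fun v => d *+ (t == v)) w
  = (c * d) *+ (s ++ t == w).
Proof.
elim: s w => [|y s IH] [|x w] /=.
- by rewrite mulr1n mulrnAr.
- have -> : Series.deriv x (fun v => c *+ ([::] == v)) = fun=> 0 by [].
  by rewrite Series.mul0l add0r mulr1n mulrnAr.
- by rewrite mul0r.
rewrite mulr0n mul0r addr0 eqseq_cons; have [<-|neq_yx] := eqVneq.
  rewrite -IH; congr Series.mul; apply: Series.seriesP => v.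
  by rewrite /Series.deriv eqseq_cons eqxx.
rewrite (_ : Series.deriv x _ = fun=> 0) ?Series.mul0l //.
apply: Series.seriesP => v.
by rewrite /Series.deriv eqseq_cons (negPf neq_yx).
Qed.

Lemma series_ofM g h :
  series_of (g * h) = Series.mul (series_of g) (series_of h).
Proof.
apply: Series.seriesP => w.
have sumE f : series_of f =
    fun w => \sum_(k <- msupp f) f@_k *+ (k == w :> word X).
  apply: Series.seriesP => v; rewrite /series_of {1}[f]monalgE raddf_sum /=.
  by apply: eq_bigr => k _; rewrite mcoeffU.
have sum_mull (I : Type) (r : seq I) F b :
    Series.mul (fun w => \sum_(i <- r) F i w) b w
    = \sum_(i <- r) Series.mul (F i) b w :> K.
  elim: r => [|i r IH].
    by rewrite big_nil -[RHS](Series.mul0l b w); congr Series.mul;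
       apply: Series.seriesP => v; rewrite big_nil.
  rewrite big_cons -IH -Series.mulDl; congr Series.mul.
  by apply: Series.seriesP => v; rewrite big_cons.
have sum_mulr (I : Type) (r : seq I) F a :
    Series.mul a (fun w => \sum_(i <- r) F i w) w
    = \sum_(i <- r) Series.mul a (F i) w :> K.
  elim: r => [|i r IH].
    by rewrite big_nil -[RHS](Series.mul0r a w); congr Series.mul;
       apply: Series.seriesP => v; rewrite big_nil.
  rewrite big_cons -IH -Series.mulDr; congr Series.mul.
  by apply: Series.seriesP => v; rewrite big_cons.
rewrite [in RHS](sumE g) [in RHS](sumE h) sum_mull /series_of mcoeffMl.
apply: eq_bigr => k _; rewrite sum_mulr; apply: eq_bigr => l _.
by rewrite series_of_monomialM.
Qed.

Lemma malg_mulf_eq0 g h : g * h = 0 -> (g == 0) || (h == 0).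
Proof.
move=> gh0; apply: contraT; rewrite negb_or => /andP[].
move=> /series_of_neq0[s gs] /series_of_neq0[t ht].
by have [w] := Series.mul_neq0 gs ht; rewrite -series_ofM gh0 /series_of mcoeff0 eqxx.
Qed.

Definition bounded n g := forall w, (n < size w)%N -> g@_w = 0.

Lemma malg_lead g : g != 0 -> exists2 w, g@_w != 0 & bounded (size w) g.
Proof.
move=> g0; pose P n := has (fun w : word X => size w == n) (msupp g).
have exP : exists n, P n.
  have [w gw] := series_of_neq0 g0; exists (size w); apply/hasP; exists w => //.
  by rewrite -mcoeff_neq0.
have ubP n : P n -> (n <= \max_(w <- msupp g) size (w : word X))%N.
  by case/hasP => w gw /eqP <-; apply: leq_bigmax_seq.
case: (ex_maxnP exP ubP) => _ /hasP[w gw /eqP <-] max_w.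
exists w; first by rewrite mcoeff_neq0.
move=> v lt_v; apply/eqP; apply: contraTT lt_v => gv; rewrite -leqNgt.
by apply: max_w; apply/hasP; exists v; rewrite -?mcoeff_neq0.
Qed.

Lemma mcoeffM_lead g h s t :
  bounded (size s) g -> bounded (size t) h -> (g * h)@_(s ++ t : word X) = g@_s * h@_t.
Proof.
move=> gs ht; rewrite -[LHS]/(series_of _ _) series_ofM.
have {}gs : forall w, (size s < size w)%N -> series_of g w = 0 by exact: gs.
rewrite -[g@_s]/(series_of g s); elim: s (series_of g) gs => [|x s IH] a as0 /=.
  case: t ht => [|x t] ht //=; rewrite (_ : Series.deriv x a = fun=> 0).
    by rewrite Series.mul0l add0r.
  by apply: Series.seriesP => w; apply: as0.
rewrite [series_of h _]ht ?mulr0 ?addr0; last by rewrite /= size_cat ltnS leq_addl.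
by apply: IH => w lt_w; apply: as0.
Qed.

Lemma malg_unit_scalar g h : h * g = 1 -> g = (g@_mone)%:MP.
Proof.
move=> hg1.
have nz : h * g != 0 by rewrite hg1 oner_neq0.
have /malg_lead[s hs ord_h] : h != 0 by apply: contraNneq nz => ->; rewrite mul0r.
have /malg_lead[t gt ord_g] : g != 0 by apply: contraNneq nz => ->; rewrite mulr0.
have := mcoeffM_lead ord_h ord_g; rewrite hg1 mcoeff1.
case: eqP => [/word_unit[_ t0] _|_ /esym/eqP]; last first.
  by rewrite mulf_eq0 (negPf hs) (negPf gt).
apply/malgP => w; rewrite mcoeffC; case: eqP => [->|]; first by rewrite mulr1n.
by case: w => // x w _; rewrite mulr0n ord_g // t0.
Qed.

Lemma malgC_comm (c : K) f : c%:MP * f = f * c%:MP.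
Proof.
apply/malgP => w; rewrite mcoeffCM (monalgE f) mulr_suml !raddf_sum mulr_sumr.
apply: eq_bigr => k _ /=.
by rewrite malgM_def fgmulUU mulm1 !mcoeffU mulrnAr [c * _]mulrC.
Qed.

Definition centralizer_pred f : {pred free_algebra K X} :=
  fun g => g * f == f * g.

(* Bergman: the centralizer of a non-scalar element is commutative. The proof  *)
(* takes place in the centralizer in the ring of series, which is a discrete   *)
(* valuation ring with residue field [K].                                      *)
Lemma centralizer_comm f : (forall c : K, f <> c%:MP) ->
  {in centralizer_pred f &, commutative *%R}.
Proof.
move=> nsc_f g h /eqP gf /eqP hf.
pose f0 := f - (f@_mone)%:MP; pose F := series_of f0.
have commE k : k * f = f * k -> Series.comm F (series_of k).
  move=> kf; rewrite /Series.comm -!series_ofM; congr series_of.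
  by rewrite mulrBr mulrBl kf malgC_comm.
have F0 : F [::] = 0.
  by rewrite -[F _]/(f0@_(mone : word X)) mcoeffB malgCK subrr.
have [t Ft] : exists t, F t != 0.
  by apply: series_of_neq0; rewrite subr_eq0; apply/eqP/nsc_f.
have FF : Series.comm F F by [].
apply: series_of_inj; rewrite !series_ofM.
apply: Series.seriesP => w; apply/eqP; apply: contraT => ncomm.
suff lt_false n : forall p s, Series.comm F p -> p [::] = 0 -> p s != 0 ->
    (size s < n)%N -> False.
  by case: (lt_false (size t).+1 F t FF F0 Ft (ltnSn _)).
elim: n => // n IH p s Fp p0 ps lt_s.
case/eqP: ncomm; apply: (congr1 (@^~ w)).
apply: (@Series.comm_uniformizer _ _ F p p0 Fp _ _ _ (commE g gf) (commE h hf)).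
move=> b Fb b0; have [[v bv]|bz] := classic (exists v, b v != 0); last first.
  exists (fun=> 0).
    by apply: Series.seriesP => v; rewrite Series.mul0l Series.mul0r.
  apply: Series.seriesP => v; rewrite Series.mul0l; apply/eqP.
  by apply: contraT => bv; case: bz; exists v.
have [//|[r Fr p_rb]] := Series.comm_chain F0 Ft Fp Fb ps bv.
have [r0|r_neq0] := eqVneq (r [::]) 0; last first.
  have b_rp : b = Series.mul (Series.inv r) p.
    by rewrite p_rb Series.mulA Series.mulVr // Series.mul1l.
  by exists (Series.inv r) => //; apply: Series.comm_cancel ps Fp Fb b_rp.
have /Series.orderP[u bu ord_b] := bv.
have lt_us : (size u < size s)%N.
  rewrite ltnNge; apply/negP => le_su; case/eqP: ps; rewrite p_rb.
  by apply: (@Series.order_geM _ _ 1 (size u)) => // -[].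
by case: (IH b u Fb b0 bu); apply: leq_trans lt_us _.
Qed.
End FreeAlgebra.

Section Centralizer.
Variables (K : fieldType) (X : finType) (f : free_algebra K X).

Fact centralizer_subring : subring_closed (centralizer_pred f).
Proof.
split=> [|g h|g h]; rewrite !unfold_in; first by rewrite mul1r mulr1.
  by move=> /eqP gf /eqP hf; rewrite mulrBl mulrBr gf hf.
by move=> /eqP gf /eqP hf; rewrite -mulrA hf mulrA gf mulrA.
Qed.

HB.instance Definition _ :=
  GRing.isSubringClosed.Build _ (centralizer_pred f) centralizer_subring.

(* The centralizer of [f], as a subring of the free algebra; the proof that [f] *)
(* is not a scalar is a parameter of the type because commutativity, needed for *)
(* the structure of integral domain, depends on it.                            *)
Record centralizer (nsc_f : forall c : K, f <> c%:MP) := Centralizer {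
  centralizer_val :> free_algebra K X;
  _ : centralizer_val \in centralizer_pred f
}.

Variable nsc_f : forall c : K, f <> c%:MP.
Notation C := (centralizer nsc_f).

HB.instance Definition _ := [isSub for @centralizer_val nsc_f].
HB.instance Definition _ := [Choice of C by <:].
HB.instance Definition _ := [SubChoice_isSubNzRing of C by <:].

Fact centralizer_mulC : @commutative C C *%R.
Proof.
move=> g h; apply: val_inj; rewrite !rmorphM.
by apply: centralizer_comm nsc_f _ _ (valP g) (valP h).
Qed.

HB.instance Definition _ :=
  GRing.PzRing_hasCommutativeMul.Build C centralizer_mulC.

Fact centralizerC (c : K) : c%:MP \in centralizer_pred f.
Proof. by rewrite unfold_in malgC_comm. Qed.

(* The units of the centralizer are the nonzero scalars.                       *)
Definition centralizer_unit : {pred C} :=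
  fun g => (val g == ((val g)@_mone)%:MP) && (val g != 0).

Definition centralizer_inv (g : C) : C :=
  if g \in centralizer_unit
  then Centralizer nsc_f (centralizerC ((val g)@_mone)^-1) else g.

Fact centralizer_mulVx :
  {in centralizer_unit, left_inverse 1 centralizer_inv *%R}.
Proof.
move=> g Ug; apply: val_inj; rewrite /centralizer_inv Ug rmorphM rmorph1 /=.
case/andP: Ug => /eqP; move: (_@__) => c /= -> c0.
by rewrite -rmorphM mulVf ?rmorph1 //; apply: contraNneq c0 => ->; rewrite rmorph0.
Qed.

Fact centralizer_unitPl (g h : C) : h * g = 1 -> centralizer_unit g.
Proof.
move=> /(congr1 val); rewrite rmorphM rmorph1 => hg1.
apply/andP; split; first by apply/eqP; apply: malg_unit_scalar hg1.
apply/eqP => g0; move/eqP: hg1.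
by rewrite [X in _ * X]g0 mulr0 eq_sym oner_eq0.
Qed.

Fact centralizer_inv_out : {in [predC centralizer_unit], centralizer_inv =1 id}.
Proof. by move=> g; rewrite inE /centralizer_inv => /negPf ->. Qed.

HB.instance Definition _ := GRing.ComNzRing_hasMulInverse.Build C
  centralizer_mulVx centralizer_unitPl centralizer_inv_out.

Fact centralizer_integral : GRing.integral_domain_axiom C.
Proof.
move=> g h /(congr1 val); rewrite rmorphM rmorph0 => /malg_mulf_eq0.
by rewrite !(inj_eq val_inj (_ : C) 0).
Qed.

HB.instance Definition _ :=
  GRing.ComUnitRing_isIntegral.Build C centralizer_integral.

End Centralizer.

(* [integralOver] is MathComp's integrality: being a root of a monic polynomial *)
(* with coefficients in the image of the given morphism.                       *)
Definition integrally_closed (R : idomainType) : Prop :=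
  forall z : {fraction R}, integralOver (@tofrac R) z ->
  exists a : R, z = tofrac a.

(* Main.v *)
Require Import Defs.
From mathcomp Require Import all_boot all_algebra finmap monalg zify.
From mathcomp Require Import generic_quotient.
From Stdlib Require Import Classical_Prop.

Set Implicit Arguments.
Unset Strict Implicit.
Unset Printing Implicit Defensive.

Import GRing.Theory.
Local Open Scope ring_scope.

(** Write R for the free algebra. Let z = a / b be a fraction of elements of the
    centralizer, integral of degree n + 1, and put c_i = a^i b^(n-i) for
    i = 0, ..., n. Integrality says that a times each c_i is b times an element
    of the right ideal J generated by the c_i.

    Any two nonzero elements of R with a nonzero common right multiple generate
    a principal right ideal: the weak (Euclidean) algorithm applies to them
    ([left_gcd]). Commuting elements have such a multiple, so J = d R
    ([commuting_ideal_principal]), and a d = b d y for some y in R. Likewise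
    a R + b R = p R, so a = p v and b = p u with u R + v R = R; cancelling p
    gives v d = u d y. The centralizer has then served its purpose. What remains
    is [coprime_denominator_trivial]: these relations, for elements u, v, d, y
    of R with u and d nonzero, force u to be a scalar. Then a lies in b R, and
    the quotient commutes with f because a and b do.

    The proof of this last fact adjoins a central variable t. In R[t] the
    elements s = u + t v and g = u d satisfy s d = g (1 + t y). Up to nonzero
    factors in K[t], they have a greatest common left divisor p, with s = p s'
    and g = p q; since s' and q are coprime on the left, q is no longer than d
    (lengths are measured in the variables X). As g = u d = p q, it follows that
    p is at least as long as u. On the other hand p divides g, which does not
    involve t, and by Gauss's lemma ([gauss_irreducible]) and a comparison of
    degrees in t ([tdegree0_factor]) p is, up to a factor in K[t], an element of
    R. It divides u + t v on the left, hence it divides both u and v, and is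
    invertible since u R + v R = R. So p, and with it u, has degree 0.

    Both the weak algorithm and Gauss's lemma are wanted over the coefficient
    ring K[t], so the weak algorithm is carried out over an arbitrary integral
    domain, multiplying by nonzero coefficients instead of dividing. *)

(** * Words, lengths and leading coefficients *)

Section Words.
Variables (A : idomainType) (X : choiceType).
Implicit Types (g h : {malg A[word X]}) (s t w : word X).

Lemma mcoeff_sum g w : g@_w = \sum_(k <- msupp g) g@_k *+ (k == w).
Proof.
by rewrite {1}[g]monalgE raddf_sum; apply: eq_bigr => k _; rewrite /= mcoeffU.
Qed.

Lemma mcoeffM_split g h w :
  (g * h)@_w =
    \sum_(i < (size w).+1) g@_(take i w : word X) * h@_(drop i w : word X).
Proof.
have cut k l : ((k ++ l == w) : nat)
    = (\sum_(i < (size w).+1) ((k == take i w) && (l == drop i w)))%N.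
  have [<-|neq] := eqVneq (k ++ l) w; last first.
    rewrite big1 // => i _; apply/eqP; rewrite eqb0.
    by apply: contraNN neq => /andP[/eqP-> /eqP->]; rewrite cat_take_drop.
  have lt_k : (size k < (size (k ++ l)).+1)%N by rewrite ltnS size_cat leq_addr.
  rewrite (bigD1 (Ordinal lt_k)) //= take_size_cat // drop_size_cat // !eqxx.
  rewrite big1 // => i neq_i; apply/eqP; rewrite eqb0.
  apply: contraNN neq_i => /andP[/eqP ki _]; apply/eqP/val_inj => /=.
  by have := congr1 size ki; rewrite size_takel // -ltnS.
have expand (i : 'I_(size w).+1) :
    g@_(take i w : word X) * h@_(drop i w : word X) =
    \sum_(k <- msupp g) \sum_(l <- msupp h)
      (g@_k * h@_l) *+ ((k == take i w) && (l == drop i w)).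
  rewrite (mcoeff_sum g) (mcoeff_sum h) mulr_suml; apply: eq_bigr => k _.
  rewrite mulr_sumr; apply: eq_bigr => l _.
  by rewrite mulrnAl mulrnAr -mulrnA mulnb andbC.
rewrite mcoeffMl (eq_bigr _ (fun i _ => expand i)).
rewrite [RHS]exchange_big; apply: eq_bigr => k _.
rewrite [RHS]exchange_big; apply: eq_bigr => l _.
by rewrite [mmul k l]/(k ++ l) cut -sumrMnr.
Qed.

(** Common source of three facts about products: additivity of lengths (I is
    {0}), Gauss's lemma (I is the ideal of an irreducible polynomial) and
    additivity of degrees in t (I is the set of polynomials of small degree).
    Among the factorizations of the word s ++ t, every one except (s, t) has a
    first factor longer than s or a second factor longer than t. *)
Lemma mcoeffM_dominant (I : A -> Prop) g h s t :
    I 0 -> (forall a b, I a -> I b -> I (a + b)) ->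
    (forall s' t', (size s < size s')%N -> I (g@_s' * h@_t')) ->
    (forall s' t', (size t < size t')%N -> I (g@_s' * h@_t')) ->
  exists2 e, I e & (g * h)@_(s ++ t : word X) = g@_s * h@_t + e.
Proof.
move=> I0 ID Ig Ih; rewrite mcoeffM_split.
have lt_s : (size s < (size (s ++ t)).+1)%N by rewrite ltnS size_cat leq_addr.
rewrite (bigD1 (Ordinal lt_s)) //= take_size_cat // drop_size_cat //.
eexists; last reflexivity; apply: big_ind => // i neq_i.
have [le_i eq_size] : (i <= size (s ++ t))%N /\ size (s ++ t) = (size s + size t)%N.
  by rewrite -ltnS ltn_ord size_cat.
have [gt_i|lt_i|eq_i] := ltngtP (size s) i.
- by apply: Ig; rewrite size_takel.
- by apply: Ih; rewrite size_drop; lia.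
- by case/eqP: neq_i; apply: val_inj.
Qed.

Lemma longest_word (P : pred A) g w : ~~ P 0 -> P g@_w ->
  exists2 s, P g@_s & forall t, (size s < size t)%N -> ~~ P g@_t.
Proof.
move=> P0 Pw; pose Q n := has (fun t : word X => P g@_t && (size t == n)) (msupp g).
have supp t : P g@_t -> t \in msupp g.
  by rewrite -mcoeff_neq0; apply: contraTneq => ->.
have exQ : exists n, Q n.
  by exists (size w); apply/hasP; exists w; rewrite ?supp ?Pw ?eqxx.
have ubQ n : Q n -> (n <= \max_(t <- msupp g) size (t : word X))%N.
  by case/hasP => t gt /andP[_ /eqP<-]; apply: leq_bigmax_seq.
case: (ex_maxnP exQ ubQ) => _ /hasP[s _ /andP[Ps /eqP<-]] max_s.
exists s => // t; apply: contraTN => Pt; rewrite -leqNgt; apply: max_s.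
by apply/hasP; exists t; rewrite ?supp ?Pt ?eqxx.
Qed.

(** As [size] does for polynomials, [wsize] exceeds the degree by one and
    vanishes at 0. *)
Definition wsize g := (\max_(w <- msupp g) (size (w : word X)).+1)%N.

Lemma wsize_gt g w : g@_w != 0 -> (size w < wsize g)%N.
Proof.
rewrite mcoeff_neq0 => gw.
exact: (@leq_bigmax_seq _ _ predT (fun w : word X => (size w).+1)).
Qed.

Lemma mcoeff_wsize g w : (wsize g <= size w)%N -> g@_w = 0.
Proof. by rewrite leqNgt; apply: contraNeq => /wsize_gt. Qed.

Lemma wsize_le g n : (forall w, (n <= size w)%N -> g@_w = 0) -> (wsize g <= n)%N.
Proof.
move=> g0; apply/bigmax_leqP_seq => w; rewrite -mcoeff_neq0 => gw _.
by rewrite ltnNge; apply: contraNN gw => /g0->.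
Qed.

Lemma wsize0 : wsize 0 = 0%N.
Proof. by apply/eqP; rewrite -leqn0; apply: wsize_le => w _; rewrite mcoeff0. Qed.

Lemma wsize_gt0 g : (0 < wsize g)%N = (g != 0).
Proof.
apply/idP/idP; first by apply: contraTneq => ->; rewrite wsize0.
apply: contraNT; rewrite -leqNgt leqn0 => /eqP g0.
by apply/eqP/malgP => w; rewrite mcoeff0 mcoeff_wsize ?g0.
Qed.

Lemma wsize_lead g : g != 0 -> exists2 w, g@_w != 0 & wsize g = (size w).+1.
Proof.
move=> g0; have [w gw] : exists w, g@_w != 0.
  have : msupp g != fset0 by rewrite msupp_eq0.
  by case/fset0Pn => w; rewrite -mcoeff_neq0; exists w.
have [||s gs max_s] := @longest_word (predC1 0) g w; rewrite ?inE ?eqxx //.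
exists s => //; apply/eqP; rewrite eqn_leq wsize_gt // andbT.
by apply: wsize_le => t /max_s; rewrite inE negbK => /eqP.
Qed.

Lemma mcoeffM_top g h s t :
    (wsize g <= (size s).+1)%N -> (wsize h <= (size t).+1)%N ->
  (g * h)@_(s ++ t : word X) = g@_s * h@_t.
Proof.
move=> gs ht; have [||||_ -> ->] := @mcoeffM_dominant (eq^~ 0) g h s t.
- by [].
- by move=> _ _ -> ->; rewrite addr0.
- by move=> s' t' lt_s; rewrite (@mcoeff_wsize g) ?mul0r //; lia.
- by move=> s' t' lt_t; rewrite (@mcoeff_wsize h) ?mulr0 //; lia.
by rewrite addr0.
Qed.

Lemma wsizeM_le g h : (wsize (g * h) <= (wsize g + wsize h).-1)%N.
Proof.
apply: wsize_le => w le_w; rewrite mcoeffM_split big1 // => i _.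
have [lt_i|le_i] := ltnP i (wsize g); last first.
  by rewrite mcoeff_wsize ?mul0r // size_takel // -ltnS.
by rewrite (@mcoeff_wsize h) ?mulr0 // size_drop; lia.
Qed.

Lemma wsizeM g h : g != 0 -> h != 0 -> wsize (g * h) = (wsize g + wsize h).-1.
Proof.
move=> /wsize_lead[s gs Es] /wsize_lead[t ht Et]; apply/eqP.
rewrite eqn_leq wsizeM_le Es Et addSn /= addnS -size_cat wsize_gt //.
by rewrite mcoeffM_top ?Es ?Et // mulf_neq0.
Qed.

Lemma malgM_neq0 g h : g != 0 -> h != 0 -> g * h != 0.
Proof.
move=> g0 h0; rewrite -wsize_gt0 wsizeM //; move: g0 h0.
by rewrite -!wsize_gt0; lia.
Qed.

Lemma malgM_eq0 g h : (g * h == 0) = (g == 0) || (h == 0).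
Proof.
apply/idP/idP; last by case/orP=> /eqP->; rewrite ?mul0r ?mulr0.
by apply: contraTT; rewrite negb_or => /andP[]; apply: malgM_neq0.
Qed.

Lemma malgMI g h h' : g != 0 -> g * h = g * h' -> h = h'.
Proof.
move=> g0 /eqP; rewrite -subr_eq0 -mulrBr malgM_eq0 (negPf g0) subr_eq0.
by move/eqP.
Qed.

Lemma malg_scalerAr (c : A) g h : g * (c *: h) = c *: (g * h).
Proof.
apply/malgP => w; rewrite mcoeffZ !mcoeffM_split mulr_sumr.
by apply: eq_bigr => i _; rewrite mcoeffZ mulrCA.
Qed.

Lemma malgZ_eq0 (c : A) g : (c *: g == 0) = (c == 0) || (g == 0).
Proof.
by rewrite -mul_malgC malgM_eq0 monalgU_eq0.
Qed.

Lemma wsizeZ (c : A) g : c != 0 -> wsize (c *: g) = wsize g.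
Proof. by move=> c0; rewrite /wsize msuppZ (negPf c0). Qed.

Lemma wsize1 : wsize 1 = 1%N.
Proof. by rewrite /wsize msuppU1 big_seq_fset1. Qed.

End Words.

(** * The weak algorithm *)

Section Euclid.
Variables (A : idomainType) (X : choiceType).
Implicit Types (a b g h : {malg A[word X]}) (s t w : word X).

(** The left transduction: [wstrip s <<w>>] is the word v if w = s ++ v,
    and 0 if s is not a prefix of w. *)
Definition wstrip s g : {malg A[word X]} :=
  [malg w in [fset (drop (size s) u : word X) | u in msupp g]%fset
     => g@_(s ++ w : word X)].

Lemma mcoeff_wstrip s g w : (wstrip s g)@_w = g@_(s ++ w : word X).
Proof.
rewrite mcoeffE; case: ifP => // /negP w_out; apply/esym/eqP.
apply: contraT => gsw; case: w_out; apply/imfsetP.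
by exists (s ++ w : word X); rewrite /= -?mcoeff_neq0 // drop_size_cat.
Qed.

(** Let beta be a longest word of b. Comparing the terms of maximal length in
    a r = b y shows that the leading forms satisfy b_beta a_(s ++ t) =
    b_s a_(beta ++ t): up to the coefficient b_beta,
    the leading form of b divides that of a on the left, and the cofactor is
    read off by stripping beta from a. *)
Lemma weak_algorithm a b r y :
    a * r = b * y -> a != 0 -> b != 0 -> r != 0 -> (wsize b <= wsize a)%N ->
  exists c, exists2 k, c != 0 & (wsize (c *: a - b * k) < wsize a)%N.
Proof.
move=> ar_by a0 b0 r0 le_ba.
have y0 : y != 0.
  by apply: contraTneq (malgM_neq0 a0 r0) => y0; rewrite ar_by y0 mulr0 eqxx.
have [beta b_beta Eb] := wsize_lead b0; have [rho r_rho Er] := wsize_lead r0.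
have a_gt0 : (0 < wsize a)%N by rewrite wsize_gt0.
have y_gt0 : (0 < wsize y)%N by rewrite wsize_gt0.
have Ey : (wsize a + wsize r = wsize b + wsize y)%N.
  by have := wsizeM a0 r0; rewrite ar_by wsizeM // Eb Er; lia.
pose m := (wsize a - wsize b)%N.
have exchange s t : size s = size beta -> size t = m ->
    b@_beta * a@_(s ++ t : word X) = b@_s * a@_(beta ++ t : word X).
  move=> Es Et.
  (* The coefficient of v ++ t ++ rho in a r = b y, where rho is a longest word
     of r: only one factorization contributes on each side. *)
  have top v : size v = size beta -> a@_(v ++ t : word X) * r@_rho
      = b@_v * y@_(t ++ rho : word X).
    move=> Ev; rewrite -!mcoeffM_top -?ar_by -?catA //.
    - by rewrite Eb Ev.
    - by rewrite size_cat; lia.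
    - by rewrite size_cat; lia.
    - by rewrite Er.
  apply: (mulIf r_rho).
  by rewrite -!mulrA !top // mulrCA.
exists b@_beta, (wstrip beta a) => //.
have k_size : (wsize (wstrip beta a) <= m.+1)%N.
  apply: wsize_le => w lt_w; rewrite mcoeff_wstrip mcoeff_wsize //.
  by rewrite size_cat; lia.
rewrite -[X in (_ < X)%N](prednK a_gt0) ltnS; apply: wsize_le => w le_w.
rewrite mcoeffB mcoeffZ; have [gt_w|] := ltnP (wsize a).-1 (size w).
  rewrite [a@_w]mcoeff_wsize; last by lia.
  rewrite mulr0 sub0r mcoeff_wsize ?oppr0 //.
  by apply: leq_trans (wsizeM_le _ _) _; lia.
move=> ge_w; have Ew : size w = (size beta + m)%N by lia.
rewrite -{1 2}[w](cat_take_drop (size beta)) mcoeffM_top.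
- by rewrite mcoeff_wstrip exchange ?subrr // ?size_takel ?size_drop; lia.
- by rewrite size_takel; lia.
- by rewrite size_drop; lia.
Qed.

(** Euclid's algorithm, up to the coefficient c. The bound on b' reflects that,
    a' and b' being coprime, (b', a') is the least solution (r, y) of
    a r = b y. Because the lengths of a, b and of the multipliers are tied by
    this equation, the bound for one multiplier gives the bound for the other,
    which keeps the induction symmetric in a and b. *)
Lemma left_gcd a b r y :
    a * r = b * y -> a != 0 -> b != 0 -> r != 0 ->
  exists c p a' b', [/\ c != 0, c *: a = p * a', c *: b = p * b',
    (wsize b' <= wsize r)%N & exists m n, p = a * m + b * n].
Proof.
have [N] := ubnP (wsize a + wsize b)%N.
elim: N a b r y => // N IH a b r y lt_N ar_by a0 b0 r0.
have y0 : y != 0.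
  by apply: contraTneq (malgM_neq0 a0 r0) => y0; rewrite ar_by y0 mulr0 eqxx.
wlog le_ba : a b r y lt_N ar_by a0 b0 r0 y0 / (wsize b <= wsize a)%N => [hyp|].
  have [|/ltnW le_ab] := leqP (wsize b) (wsize a); first exact: hyp ar_by _ _ _ _.
  have [|c [p [b' [a' [c0 cb ca le_a' [m [n Ep]]]]]]] :=
    hyp b a y r _ (esym ar_by) b0 a0 y0 r0 le_ab; first by rewrite addnC.
  exists c, p, a', b'; split=> //; last by exists n, m; rewrite addrC.
  have := wsizeM a0 r0; rewrite ar_by wsizeM // => Ear.
  have := wsizeZ a c0; have := wsizeZ b c0.
  have: c *: b != 0 by rewrite malgZ_eq0 negb_or c0.
  have: c *: a != 0 by rewrite malgZ_eq0 negb_or c0.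
  rewrite ca cb !malgM_eq0 !negb_or => /andP[p0 a'0] /andP[_ b'0].
  rewrite !wsizeM //; move: a0 b0 r0 y0 p0 a'0 b'0; rewrite -!wsize_gt0; lia.
have [c1 [k c10 lt_a1]] := weak_algorithm ar_by a0 b0 r0 le_ba.
set a1 := c1 *: a - b * k in lt_a1; have Ea : c1 *: a = a1 + b * k by rewrite subrK.
have [a10|a10] := eqVneq a1 0.
  exists c1, b, k, c1%:MP; split=> //.
  - by rewrite Ea a10 add0r.
  - by rewrite -[c1%:MP]mulr1 mul_malgC malg_scalerAr mulr1.
  - rewrite -[c1%:MP]mulr1 mul_malgC wsizeZ // wsize1 wsize_gt0 //.
  by exists 0, 1; rewrite mulr0 mulr1 add0r.
have a1r : a1 * r = b * (c1 *: y - k * r).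
  by rewrite mulrBl -scalerAl mulrBr malg_scalerAr ar_by mulrA.
move: a1 lt_a1 Ea a10 a1r => a1 lt_a1 Ea a10 a1r.
have [|c [p [a' [b' [c0 ca1 cb le_b' [m [n Ep]]]]]]] := IH _ _ _ _ _ a1r a10 b0 r0.
  by move: lt_a1 lt_N; lia.
exists (c * c1), p, (a' + b' * k), (c1 *: b'); split.
- by rewrite mulf_neq0.
- by rewrite -scalerA Ea scalerDr ca1 [c *: (b * k)]scalerAl cb mulrDr
    [p * (b' * k)]mulrA.
- by rewrite mulrC -scalerA cb malg_scalerAr.
- by rewrite wsizeZ.
exists (c1 *: m), (n - k * m).
rewrite Ep malg_scalerAr scalerAl Ea mulrDl mulrBr mulrA.
by rewrite -addrA; congr (_ + _); rewrite [RHS]addrC subrK.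
Qed.

End Euclid.

(** * A central variable and Gauss's lemma *)

Section MapCoeff.
Variables (A B : idomainType) (X : choiceType) (f : A -> B).
Hypothesis f0 : f 0 = 0.

Definition map_coeff (g : {malg A[word X]}) : {malg B[word X]} :=
  [malg w in msupp g => f g@_w].

Lemma mcoeff_map g w : (map_coeff g)@_w = f g@_w.
Proof. by rewrite mcoeffE; case: msuppP. Qed.
End MapCoeff.

Section Gauss.
Variables (K : fieldType) (X : choiceType).
Local Notation R := {malg K[word X]}.
Local Notation Rt := {malg {poly K}[word X]}.
Implicit Types (g h : R) (P Q : Rt) (w : word X).

Definition tconst g : Rt := map_coeff polyC g.

Lemma mcoeff_tconst g w : (tconst g)@_w = (g@_w)%:P.
Proof. exact: mcoeff_map. Qed.

(** The coefficient of t^j, t being the indeterminate of [{poly K}]. *)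
Definition tcoef j P : R := map_coeff (fun a : {poly K} => a`_j) P.

Lemma mcoeff_tcoef j P w : (tcoef j P)@_w = P@_w`_j.
Proof. by apply: mcoeff_map; rewrite coef0. Qed.

Lemma tconstM g h : tconst (g * h) = tconst g * tconst h.
Proof.
apply/malgP => w; rewrite mcoeff_tconst !mcoeffM_split rmorph_sum /=.
by apply: eq_bigr => i _; rewrite rmorphM !mcoeff_tconst.
Qed.

Lemma tcoef_tconstM j g P : tcoef j (tconst g * P) = g * tcoef j P.
Proof.
apply/malgP => w; rewrite mcoeff_tcoef !mcoeffM_split coef_sum.
by apply: eq_bigr => i _; rewrite mcoeff_tconst coefCM mcoeff_tcoef.
Qed.

Lemma wsize_tconst g : wsize (tconst g) = wsize g.
Proof.
by apply/eqP; rewrite eqn_leq; apply/andP; split; apply: wsize_le => w le_w;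
   [rewrite mcoeff_tconst | apply: polyC_inj; rewrite -mcoeff_tconst];
   rewrite mcoeff_wsize.
Qed.

Lemma tconst_eq0 g : (tconst g == 0) = (g == 0).
Proof. by apply: negb_inj; rewrite -!wsize_gt0 wsize_tconst. Qed.

Lemma irreducible_factor (c : {poly K}) : (1 < size c)%N ->
  exists2 q, irreducible_poly q & q %| c.
Proof.
have [n] := ubnP (size c); elim: n c => // n IH c lt_n c_gt1.
have [irr_c|red_c] := classic (irreducible_poly c); first by exists c.
have [q [q1 qc nqc]] : exists q : {poly K}, [/\ size q != 1%N, q %| c & ~~ (q %= c)].
  apply: NNPP => no_q; apply: red_c; split=> // q q1 qc.
  by apply: contraT => nqc; case: no_q; exists q.
have c0 : c != 0 by rewrite -size_poly_gt0; lia.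
have q0 : q != 0 by apply: contraTneq qc => ->; rewrite dvd0p.
have lt_qc : (size q < size c)%N.
  by rewrite ltn_neqAle dvdp_leq // andbT dvdp_size_eqp.
have [||p irr_p pq] := IH q; first by lia.
  by move: q1; rewrite -size_poly_gt0 in q0; lia.
by exists p => //; apply: dvdp_trans pq qc.
Qed.

(** If neither factor is divisible by q, take in each a longest word with a
    coefficient prime to q; modulo q only these contribute to the coefficient of
    their concatenation in the product. *)
Lemma gauss_irreducible (q : {poly K}) P Q : irreducible_poly q ->
    (forall w, q %| (P * Q)@_w) ->
  (forall w, q %| P@_w) \/ (forall w, q %| Q@_w).
Proof.
move=> irr_q qPQ; apply: NNPP => /not_or_and[nP nQ].
have undivided (P' : Rt) : ~ (forall w, q %| P'@_w) ->
    exists2 s, ~~ (q %| P'@_s) & forall t, (size s < size t)%N -> q %| P'@_t.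
  move=> nP'; have [w Pw] : exists w, ~~ (q %| P'@_w).
    apply: NNPP => no_w; case: nP' => w.
    by apply/negPn/negP => ?; case: no_w; exists w.
  have [||s Ps max_s] := @longest_word _ _ (fun a => ~~ (q %| a)) P' w => //.
    by rewrite negbK dvdp0.
  by exists s => // t /max_s; rewrite negbK.
have [s Ps max_s] := undivided P nP; have [t Qt max_t] := undivided Q nQ.
have [||||e qe Est] := @mcoeffM_dominant _ _ (fun a => q %| a) P Q s t.
- exact: dvdp0.
- by move=> a b; apply: dvdp_add.
- by move=> s' t' lt_s; rewrite dvdp_mulr ?max_s.
- by move=> s' t' lt_t; rewrite dvdp_mull ?max_t.
have := qPQ (s ++ t : word X); rewrite Est dvdp_addl // Gauss_dvdpr ?(negPf Qt) //.
by rewrite irreducible_poly_coprime.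
Qed.

Lemma dvdp_coeffs (q : {poly K}) P : (forall w, q %| P@_w) -> exists P', P = q *: P'.
Proof.
move=> qP; exists (map_coeff (fun a => a %/ q) P); apply/malgP => w.
by rewrite mcoeffZ mcoeff_map ?div0p // mulrC divpK.
Qed.

Lemma malgZI (q : {poly K}) P P' : q != 0 -> q *: P = q *: P' -> P = P'.
Proof.
by move=> q0 /eqP; rewrite -subr_eq0 -scalerBr malgZ_eq0 (negPf q0) subr_eq0 => /eqP.
Qed.

(** The irreducible factors of c are cancelled one at a time, each from one of
    the two factors P and Q. *)
Lemma gauss_clear (c : {poly K}) g P Q : c != 0 -> c *: tconst g = P * Q ->
  exists (k a : {poly K}) P' Q',
    [/\ size k = 1%N, P = a *: P' & k *: tconst g = P' * Q'].
Proof.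
have [n] := ubnP (size c); elim: n c P Q => // n IH c P Q lt_n c0 cg.
have [le_c1|c_gt1] := leqP (size c) 1.
  exists c, 1, P, Q; split=> //; last by rewrite scale1r.
  by apply/eqP; rewrite eqn_leq le_c1 size_poly_gt0.
have [q irr_q qc] := irreducible_factor c_gt1; have q0 := irredp_neq0 irr_q.
have [c' Ec] : exists c' : {poly K}, c = q * c'.
  by exists (c %/ q); rewrite mulrC divpK.
have c'0 : c' != 0.
  by apply: contraNneq c0 => c'0; rewrite Ec c'0 mulr0.
have lt_c' : (size c' < n)%N.
  have q1 : (1 < size q)%N by case: irr_q.
  have Esize : size c = (size q + size c').-1 by rewrite Ec size_mul.
  by move: lt_n; lia.
have [|/dvdp_coeffs[P' EP]|/dvdp_coeffs[Q' EQ]] := @gauss_irreducible q P Q irr_q.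
- by move=> w; rewrite -cg mcoeffZ dvdp_mulr.
- have [|k [a [P0 [Q0 [k1 E1 E2]]]]] := IH c' P' Q lt_c' c'0.
    by apply: (malgZI q0); rewrite scalerA -Ec cg EP scalerAl.
  by exists k, (q * a), P0, Q0; split=> //; rewrite EP E1 scalerA.
have [|k [a [P0 [Q0 [k1 E1 E2]]]]] := IH c' P Q' lt_c' c'0.
  by apply: (malgZI q0); rewrite scalerA -Ec cg EQ malg_scalerAr.
by exists k, a, P0, Q0.
Qed.

(** A word leading for the degree in t first, and then for the length. *)
Lemma tdegree_longest P : P != 0 -> exists m s, [/\ (0 < m)%N, size P@_s = m,
  forall t, (size P@_t <= m)%N & forall t, (size s < size t)%N -> (size P@_t < m)%N].
Proof.
move=> P0; pose m := (\max_(w <- msupp P) size P@_w)%N.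
have le_m t : (size P@_t <= m)%N.
  case: msuppP => [tP|]; last by rewrite size_poly0.
  exact: (@leq_bigmax_seq _ _ predT (fun w => size P@_w)).
have [w Pw _] := wsize_lead P0.
have m_gt0 : (0 < m)%N by apply: leq_trans (le_m w); rewrite size_poly_gt0.
have [v Pv] : exists v, (m <= size P@_v)%N.
  apply: NNPP => no_v; have: (m <= m.-1)%N; last by lia.
  apply/bigmax_leqP_seq => v _ _; rewrite -ltnS prednK // ltnNge.
  by apply/negP => ?; case: no_v; exists v.
have [||s Ps max_s] :=
  @longest_word _ _ (fun a : {poly K} => m <= size a)%N P v => //.
  by rewrite size_poly0 -ltnNge.
exists m, s; split=> // [|t /max_s]; last by rewrite -ltnNge.
by apply/eqP; rewrite eqn_leq le_m.
Qed.

(** The degree in t of a product is the sum of the degrees. *)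
Lemma tdegree0_factor (k : {poly K}) g P Q :
  size k = 1%N -> g != 0 -> k *: tconst g = P * Q -> exists p, P = tconst p.
Proof.
move=> k1 g0 kg; have: k *: tconst g != 0.
  by rewrite malgZ_eq0 tconst_eq0 negb_or g0 -size_poly_gt0 k1.
rewrite kg malgM_eq0 negb_or => /andP[/tdegree_longest[m [s [m0 Ps le_m lt_m]]]].
move=> /tdegree_longest[n [t [n0 Qt le_n lt_n]]].
have prod_size (a b : {poly K}) i j :
    (size a <= i)%N -> (size b <= j)%N -> (size (a * b)%R <= (i + j).-1)%N.
  move=> le_a le_b; apply: leq_trans (size_polyMleq _ _) _.
  by rewrite -!subn1 leq_sub2r // leq_add.
have [||||e lt_e Est] :=
  @mcoeffM_dominant _ _ (fun a : {poly K} => size a < (m + n).-1)%N P Q s t.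
- by rewrite size_poly0; lia.
- move=> a b lt_a lt_b; apply: leq_ltn_trans (size_polyD _ _) _.
  by rewrite gtn_max lt_a.
- move=> s' t' /lt_m lt_s; apply: leq_ltn_trans (prod_size _ _ m.-1 n _ (le_n _)) _.
    by rewrite -ltnS prednK.
  by lia.
- move=> s' t' /lt_n lt_t; apply: leq_ltn_trans (prod_size _ _ m n.-1 (le_m _) _) _.
    by rewrite -ltnS prednK.
  by lia.
have PQ : size (P@_s * Q@_t) = (m + n).-1.
  by rewrite size_mul ?Ps ?Qt // -size_poly_gt0 ?Ps ?Qt.
have: size (P * Q)@_(s ++ t : word X) = (m + n).-1 by rewrite Est size_polyDl PQ.
rewrite -kg mcoeffZ mcoeff_tconst => Emn.
have := prod_size k (g@_(s ++ t : word X))%:P 1 1; rewrite Emn k1 size_polyC leq_b1.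
move=> /(_ isT isT) le_mn.
exists (tcoef 0 P); apply/malgP => w; rewrite mcoeff_tconst mcoeff_tcoef.
by apply: size1_polyC; apply: leq_trans (le_m w) _; lia.
Qed.

Lemma wsize_rinv p p' : p * p' = 1 :> R -> wsize p = 1%N.
Proof.
move=> pp'; have: p * p' != 0 by rewrite pp' oner_neq0.
rewrite malgM_eq0 negb_or => /andP[p0 p'0].
have := wsizeM p0 p'0; rewrite pp' wsize1.
by move: p0 p'0; rewrite -!wsize_gt0; lia.
Qed.

(** The fraction u^-1 v equals d z d^-1, so d is a common denominator of all its
    powers, which is incompatible with a nontrivial u. The relation is exploited
    through u + t v, the generic member of the pencil spanned by u and v. *)
Lemma coprime_denominator_trivial (u v d z m n : R) :
  u != 0 -> d != 0 -> u * m + v * n = 1 -> v * d = u * d * z -> wsize u = 1%N.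
Proof.
move=> u0 d0 bezout vd.
pose s : Rt := tconst u + 'X *: tconst v.
have ud0 : u * d != 0 by apply: malgM_neq0.
have s0 : s != 0.
  have [w uw _] := wsize_lead u0; apply: contraNneq uw => s0.
  have := congr1 (fun P : Rt => P@_w`_0) s0.
  rewrite mcoeffD mcoeffZ !mcoeff_tconst mcoeff0 coef0 coefD coefC coefXM addr0.
  by move=> ->.
have sd : s * tconst d = tconst (u * d) * (1 + 'X *: tconst z).
  by rewrite mulrDl mulrDr mulr1 malg_scalerAr -scalerAl -!tconstM vd.
have [||c [p [S [Q [c0 cs cg le_Q _]]]]] := left_gcd sd s0.
- by rewrite tconst_eq0.
- by rewrite tconst_eq0.
(* The divisor p of u d does not depend on t, up to a factor in K[t]. *)
have [k [a [P' [Q' [k1 Ep Ek]]]]] := gauss_clear c0 cg.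
have [q EP'] := tdegree0_factor k1 ud0 Ek.
have: c *: s != 0 by rewrite malgZ_eq0 negb_or c0.
rewrite cs malgM_eq0 negb_or => /andP[p0 _].
have: c *: tconst (u * d) != 0 by rewrite malgZ_eq0 negb_or c0 tconst_eq0.
rewrite cg malgM_eq0 negb_or => /andP[_ Q0].
have le_up : (wsize u <= wsize p)%N.
  have := congr1 (@wsize _ _) cg; rewrite wsizeZ // wsize_tconst !wsizeM //.
  move: le_Q p0 Q0 u0 d0; rewrite -!wsize_gt0 wsize_tconst; lia.
have a0 : a != 0 by apply: contraNneq p0 => a0; rewrite Ep a0 scale0r.
have Epq : wsize p = wsize q by rewrite Ep EP' wsizeZ // wsize_tconst.
have {}cs : c *: s = tconst q * (a *: S) 
  by rewrite cs Ep EP' [RHS]malg_scalerAr -[LHS]scalerAl.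
(* With l the leading coefficient of c, the two highest coefficients of
   c (u + t v) in t are l v and l u + b v, and both are divisible by q. *)
have tcoef_s j w : (tcoef j (c *: s))@_w =
    c`_j * u@_w + (if j is i.+1 then c`_i else 0) * v@_w.
  rewrite mcoeff_tcoef mcoeffZ mcoeffD mcoeffZ !mcoeff_tconst mulrDr coefD coefMC.
  congr (_ + _); rewrite mulrA coefMC coefMX.
  by case: j.
have Ec : (size c).-1.+1 = size c by rewrite prednK ?size_poly_gt0.
pose l := lead_coef c; have l0 : l != 0 by rewrite lead_coef_eq0.
have Ev : v = q * (l^-1 *: tcoef (size c) (a *: S)).
  rewrite malg_scalerAr -tcoef_tconstM -cs; apply/malgP => w.
  rewrite mcoeffZ tcoef_s -Ec Ec (nth_default _ (leqnn _)) mul0r add0r.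
  by rewrite mulKf.
have [u' Eu] : exists u', u = q * u'.
  pose b := if (size c).-1 is i.+1 then c`_i else 0.
  exists (l^-1 *: (tcoef (size c).-1 (a *: S)
                    - b *: (l^-1 *: tcoef (size c) (a *: S)))).
  rewrite malg_scalerAr mulrBr -tcoef_tconstM -cs malg_scalerAr -Ev.
  apply/malgP => w.
  by rewrite mcoeffZ mcoeffB mcoeffZ tcoef_s addrK mulKf.
have: q * (u' * m + l^-1 *: tcoef (size c) (a *: S) * n) = 1.
  by rewrite mulrDr !mulrA -Ev -Eu.
move/wsize_rinv => q1; move: u0; rewrite -wsize_gt0; lia.
Qed.

End Gauss.

(** * Commuting elements *)

Section Commuting.
Variables (K : fieldType) (X : choiceType).
Local Notation R := {malg K[word X]}.
Implicit Types (a b d p r y : R).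

Lemma right_sum_principal a b r y :
    a * r = b * y -> a != 0 -> b != 0 -> r != 0 ->
  exists p a' b' m n, [/\ a = p * a', b = p * b' & p = a * m + b * n].
Proof.
move=> ar_by a0 b0 r0.
have [c [p [a' [b' [c0 Ea Eb _ [m [n Ep]]]]]]] := left_gcd ar_by a0 b0 r0.
exists p, (c^-1 *: a'), (c^-1 *: b'), m, n; split=> //.
  by rewrite malg_scalerAr -Ea scalerA mulVf // scale1r.
by rewrite malg_scalerAr -Eb scalerA mulVf // scale1r.
Qed.

(** When d generates the ideal of c_0, ..., c_n, the element
    c_0 c_(n+1) = c_(n+1) c_0 is a common right multiple of d and c_(n+1), so
    these two have a greatest common left divisor that is a combination of
    them. *)
Lemma commuting_ideal_principal (c : nat -> R) n :
    c 0%N != 0 -> (forall i, c i * c 0%N = c 0%N * c i) ->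
  exists d, [/\ d != 0, forall i, (i <= n)%N -> exists e, c i = d * e
    & exists r : nat -> R, d = \sum_(i < n.+1) c i * r i].
Proof.
move=> c0 comm; elim: n => [|n [d [d0 div_d [r Ed]]]].
  exists (c 0%N); split=> //; last by exists (fun=> 1); rewrite big_ord1 mulr1.
  by move=> i; rewrite leqn0 => /eqP->; exists 1; rewrite mulr1.
have [cn0|cn0] := eqVneq (c n.+1) 0.
  exists d; split=> // [i|]; last first.
    by exists r; rewrite big_ord_recr /= -Ed cn0 mul0r addr0.
  rewrite leq_eqVlt => /predU1P[->|]; last exact: div_d.
  by exists 0; rewrite mulr0.
have [e Ee] := div_d 0%N (leq0n n).
have meet : d * (e * c n.+1) = c n.+1 * c 0%N by rewrite mulrA -Ee comm.
have ec0 : e * c n.+1 != 0.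
  rewrite malgM_eq0 (negPf cn0) orbF.
  by apply: contraNneq c0 => e0; rewrite Ee e0 mulr0.
have [p [d' [c' [m [l [Ed' Ec' Ep]]]]]] := right_sum_principal meet d0 cn0 ec0.
exists p; split.
- by apply: contraNneq d0 => p0; rewrite Ed' p0 mul0r.
- move=> i; rewrite leq_eqVlt => /predU1P[->|/div_d[f ->]]; first by exists c'.
  by exists (d' * f); rewrite Ed' mulrA.
exists (fun i => if (i <= n)%N then r i * m else l).
rewrite big_ord_recr /= ltnn Ep; congr (_ + _).
rewrite {1}Ed mulr_suml; apply: eq_bigr => i _.
by rewrite -ltnS ltn_ord mulrA.
Qed.

Lemma wsize1_scalar p : wsize p = 1%N -> p = (p@_mone)%:MP.
Proof.
move=> p1; apply/malgP => w; rewrite mcoeffC; case: eqP => [->|/eqP w0].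
  by rewrite mulr1n.
by rewrite mulr0n mcoeff_wsize // p1; case: w w0.
Qed.

(** An equation of integral dependence for a / b, cleared of denominators; the
    elements al i stand for the coefficients of the monic polynomial. *)
Lemma commuting_integral_dvd n a b (al : nat -> R) :
    b != 0 -> GRing.comm a b -> (forall i, GRing.comm (al i) a) ->
    (forall i, GRing.comm (al i) b) ->
    a ^+ n.+1 = \sum_(i < n.+1) al i * (a ^+ i * b ^+ (n.+1 - i)) ->
  exists e, a = b * e.
Proof.
move=> b0 ab al_a al_b int_a.
have [->|a0] := eqVneq a 0; first by exists 0; rewrite mulr0.
have bX0 k : b ^+ k != 0.
  by elim: k => [|k IH]; rewrite ?expr0 ?oner_neq0 // exprS malgM_neq0.
(* The right ideal generated by the c i is mapped into b times itself by a. *)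
pose c i := a ^+ i * b ^+ (n - i).
have c_comm i : c i * c 0%N = c 0%N * c i.
  rewrite /c expr0 mul1r subn0; apply/esym/commrM; apply: commrX.
    by apply/commr_sym/commrX.
  exact/commr_sym/commrX.
have [|d [d0 div_d [r Ed]]] := @commuting_ideal_principal c n _ c_comm.
  by rewrite /c expr0 mul1r.
have shift i : (i <= n)%N -> a ^+ i * b ^+ (n.+1 - i) = b * c i.
  move=> le_i; rewrite subSn // exprS !mulrA; congr (_ * _).
  exact/esym/commrX/commr_sym.
have stable i : (i <= n)%N -> exists z, a * c i = b * d * z.
  rewrite leq_eqVlt => /predU1P[->|lt_i]; last first.
    have [e Ee] := div_d i.+1 lt_i; exists e; rewrite -mulrA -Ee -shift //.
    by rewrite /c mulrA -exprS subSS.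
  rewrite /c subnn expr0 mulr1 -exprS int_a.
  apply: (big_ind (fun x => exists z, x = b * d * z)) => [|x y [z Ex] [t Ey]|j _].
  - by exists 0; rewrite mulr0.
  - by exists (z + t); rewrite mulrDr Ex Ey.
  have le_j : (j <= n)%N by rewrite -ltnS.
  have [e Ee] := div_d j le_j; exists (e * al j).
  have al_c : al j * c j = c j * al j by apply: commrM; apply: commrX.
  by rewrite (shift _ le_j) mulrA (al_b j) -mulrA al_c Ee !mulrA.
have [z ad] : exists z, a * d = b * d * z.
  rewrite {1}Ed mulr_sumr.
  apply: (big_ind (fun x => exists z, x = b * d * z)) => [|x y [z Ex] [t Ey]|i _].
  - by exists 0; rewrite mulr0.
  - by exists (z + t); rewrite mulrDr Ex Ey.
  have [|z Ez] := stable i; first by rewrite -ltnS.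
  by exists (z * r i); rewrite mulrA Ez mulrA.
have [p [v [u [m [l [Ea Eb Ep]]]]]] := right_sum_principal ab a0 b0 b0.
have p0 : p != 0 by apply: contraNneq b0 => p0; rewrite Eb p0 mul0r.
have u0 : u != 0 by apply: contraNneq b0 => u0; rewrite Eb u0 mulr0.
have bezout : u * l + v * m = 1.
  by apply: (malgMI p0); rewrite mulrDr !mulrA -Ea -Eb mulr1 addrC -Ep.
have vd : v * d = u * d * z.
  by apply: (malgMI p0); rewrite !mulrA -Ea -Eb ad.
have := coprime_denominator_trivial u0 d0 bezout vd => /wsize1_scalar.
move: (u@_ _) => k Eu; exists (k^-1 *: v).
have k0 : k != 0 by apply: contraNneq u0 => k0; rewrite Eu k0 malgC0E.
rewrite Eb Eu malg_scalerAr -mulrA mul_malgC malg_scalerAr scalerA mulVf //.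
by rewrite scale1r.
Qed.
End Commuting.

Lemma fraction_div (D : idomainType) (z : {fraction D}) :
  exists2 ab : D * D, ab.2 != 0 & z * tofrac ab.2 = tofrac ab.1.
Proof.
elim/quotW: z => x; exists (\n_x, \d_x); first exact: denom_ratioP.
rewrite /=; unlock FracField.tofrac; rewrite -[LHS]FracField.pi_mul.
apply/eqmodP; rewrite /= FracField.equivfE /FracField.mulf.
by rewrite !numden_Ratio ?(oner_neq0, mulf_neq0, denom_ratioP) // !mulr1 mulrC.
Qed.

(** A monic polynomial of degree 0 has no root, which makes it possible to write
    the degree as n + 1. *)
Lemma integral_fraction (D : idomainType) (z : {fraction D}) (a b : D) :
    b != 0 -> z * tofrac b = tofrac a -> integralOver (@tofrac D) z ->
  exists n (al : nat -> D),
    a ^+ n.+1 = \sum_(i < n.+1) al i * (a ^+ i * b ^+ (n.+1 - i)).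
Proof.
move=> b0 zb [p mon_p /rootP].
have [n Esize] : exists n, size p = n.+1.
  by exists (size p).-1; rewrite prednK // size_poly_gt0 monic_neq0.
have lead_p : p`_n = 1 by move/monicP: mon_p; rewrite lead_coefE Esize.
rewrite horner_coef size_map_poly_id0; last first.
  by rewrite (monicP mon_p) rmorph1 oner_neq0.
rewrite Esize => pz; have {pz} : \sum_(i < n.+1) p`_i * (a ^+ i * b ^+ (n - i)) = 0.
  apply/eqP; rewrite -tofrac_eq0 rmorph_sum; apply/eqP.
  transitivity (0 * tofrac b ^+ n); last exact: mul0r.
  rewrite -[in RHS]pz mulr_suml; apply: eq_bigr => i _.
  rewrite coef_map /= !tofracM !tofracXn -zb exprMn -!mulrA -exprD subnKC //.
  by rewrite -ltnS.
case: n => [|n] in Esize lead_p *.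
  by rewrite big_ord1 lead_p mul1r mulr1 => /eqP; rewrite oner_eq0.
rewrite big_ord_recr /= lead_p mul1r subnn expr0 mulr1 => /eqP.
rewrite addrC addr_eq0 => /eqP Ea; exists n, (fun i => - p`_i).
by rewrite Ea -sumrN; apply: eq_bigr => i _; rewrite mulNr.
Qed.

Theorem theorem2p11 (K : fieldType) (X : finType) (two_vars : (2 <= #|X|)%N)
  (f : free_algebra K X) (f_nonscalar : forall c : K, f <> c%:MP) :
  integrally_closed (centralizer f_nonscalar).
Proof.
move=> z int_z; have [[a b] /= b0 zb] := fraction_div z.
have [n [al int_a]] := integral_fraction b0 zb int_z.
have vb0 : val b != 0 by rewrite -(inj_eq val_inj b 0) in b0.
have valC (x y : centralizer f_nonscalar) : GRing.comm (val x) (val y).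
  by rewrite /GRing.comm -!rmorphM mulrC.
have [|e Ee] := @commuting_integral_dvd K X n (val a) (val b) (fun i => val (al i))
  vb0 (valC a b) (fun i => valC _ _) (fun i => valC _ _).
  rewrite -rmorphXn int_a rmorph_sum; apply: eq_bigr => i _.
  by rewrite !rmorphM !rmorphXn.
have fe : e \in centralizer_pred f.
  rewrite unfold_in; apply/eqP; apply: (malgMI vb0).
  have /eqP fa := valP a; have /eqP fb := valP b.
  by rewrite !mulrA -Ee fa fb -mulrA -Ee.
exists (Centralizer f_nonscalar fe).
have tb0 : tofrac b != 0 by rewrite tofrac_eq0.
apply: (mulIf tb0); rewrite zb -tofracM mulrC; congr tofrac.
by apply: val_inj; rewrite rmorphM Ee.
Qed.
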